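(* Let $V$ be any $A$-module, where $A=\mathbf{k}((t))$. The map $\Psi: RB(V)\to \mathrm{RSD}(V)$ defined by $\Psi(p)=(\operatorname{im}(p),\ker(p))$ is a $GL_A(V)$-equivariant bijection.
   Context: Let $\mathbf{k}$ be a field, $\mathcal{O}=\mathbf{k}[[t]]$, $A=\mathbf{k}((t))$, $A^-=t^{-1}\mathbf{k}[t^{-1}]$, so $A=\mathcal{O}\oplus A^-$ as $\mathbf{k}$-vector spaces; let $P:A\to A$ be the $\mathbf{k}$-linear projection onto $\mathcal{O}$ with kernel $A^-$. For an $A$-module $V$, a $\mathbf{k}$-linear map $p:V\to V$ is a Rota-Baxter representation operator on $V$ if $P(a)p(x)=p(P(a)x+ap(x)-ax)$ for all $a\in A$, $x\in V$. $RB(V)$ is the set of all Rota-Baxter representation operators on $V$; $GL_A(V)$ (the group of invertible $A$-linear maps of $V$) acts on it by $\phi\cdot p=\phi\circ p\circ\phi^{-1}$. A regular-singular decomposition (RSD) of $V$ is a pair $(M,N)$ of $\mathbf{k}$-subspaces with $V=M\oplus N$ as $\mathbf{k}$-vector space, $M$ an $\mathcal{O}$-submodule of $V$ and $N$ a $\mathbf{k}[t^{-1}]$-submodule of $V$. $\mathrm{RSD}(V)$ is the set of all RSDs of $V$; $GL_A(V)$ acts on it by $\phi(M,N)=(\phi(M),\phi(N))$. *)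

(* Defs.v *)
From HB Require Import structures.
From mathcomp Require Import all_boot all_order all_algebra.
From mathcomp Require Import boolp classical_sets functions cardinality fsbigop.
From mathcomp Require Import zify ring.
Set Implicit Arguments.
Unset Strict Implicit.
Unset Printing Implicit Defensive.
Import Order.TTheory GRing.Theory Num.Theory.
Local Open Scope classical_set_scope.
Local Open Scope ring_scope.

(** * The ring k((t)) of formal Laurent series *)

Record laurent (k : fieldType) := Laurent {
  lcoef :> int -> k;
  lcoefP : exists n : int, forall m : int, m < n -> lcoef m = 0 }.

Lemma lcoef_inj (k : fieldType) (f g : laurent k) :
  (forall m, f m = g m) -> f = g.
Proof.
case: f g => [f fP] [g gP] /= /funext fg.
by case: _ / fg gP => gP; rewrite (Prop_irrelevance fP gP).
Qed.

HB.instance Definition _ (k : fieldType) := gen_eqMixin (laurent k).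
HB.instance Definition _ (k : fieldType) := gen_choiceMixin (laurent k).

Section Ring.
Variable k : fieldType.
Implicit Types f g h : laurent k.

Definition lbound f (N : nat) := forall m : int, m < - N%:Z -> f m = 0.

Lemma lboundP f : exists N, lbound f N.
Proof.
case: (lcoefP f) => n fn; exists (absz n) => m mn; apply: fn; lia.
Qed.

Lemma lbound_le f N N' : (N <= N')%N -> lbound f N -> lbound f N'.
Proof. by move=> NN' fN m mN; apply: fN; lia. Qed.

Lemma lbound2 f g : exists N, lbound f N /\ lbound g N.
Proof.
have [N fN] := lboundP f; have [N' gN'] := lboundP g; exists (N + N')%N.
by split; [apply: lbound_le fN | apply: lbound_le gN']; lia.
Qed.

Fact ladd_subproof f g :
  exists n : int, forall m, m < n -> f m + g m = 0.
Proof.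
have [N [fN gN]] := lbound2 f g; exists (- N%:Z) => m mN.
by rewrite fN// gN// addr0.
Qed.
Definition ladd f g := Laurent (ladd_subproof f g).

Fact lopp_subproof f : exists n : int, forall m, m < n -> - f m = 0.
Proof. by case: (lcoefP f) => n fn; exists n => m /fn ->; rewrite oppr0. Qed.
Definition lopp f := Laurent (lopp_subproof f).

Fact lscale_subproof (c : k) f : exists n : int, forall m, m < n -> c * f m = 0.
Proof. by case: (lcoefP f) => n fn; exists n => m /fn ->; rewrite mulr0. Qed.
Definition lscale c f := Laurent (lscale_subproof c f).

Fact lzero_subproof :
  exists n : int, forall m : int, m < n -> (fun=> 0 : k) m = 0.
Proof. by exists 0. Qed.
Definition lzero := Laurent lzero_subproof.

Fact lmono_subproof (e : int) :
  exists n : int, forall m : int, m < n -> (m == e)%:R = 0 :> k.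
Proof. by exists e => m me; rewrite lt_eqF. Qed.
(** the monomial t ^ e *)
Definition lmono (e : int) := Laurent (lmono_subproof e).

(** The sum below has finite support, since [f] and [g] are bounded below. *)
Definition lmul_coef f g (m : int) : k :=
  \sum_(i \in [set: int]) f i * g (m - i).

Lemma lmul_coef_bound f g N N' : lbound f N -> lbound g N' ->
  forall m, m < - (N + N')%:Z -> lmul_coef f g m = 0.
Proof.
move=> fN gN m mN; apply: fsbig1 => i _.
have [iN|iN] := ltP i (- N%:Z); first by rewrite fN// mul0r.
by rewrite gN ?mulr0//; lia.
Qed.

Fact lmul_subproof f g :
  exists n : int, forall m : int, m < n -> lmul_coef f g m = 0.
Proof.
have [N [fN gN]] := lbound2 f g.
by exists (- (N + N)%:Z); exact: lmul_coef_bound.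
Qed.
Definition lmul f g := Laurent (lmul_subproof f g).

Lemma fsum_seq (r : seq int) (F : int -> k) : uniq r ->
  (forall i, i \notin r -> F i = 0) ->
  \sum_(i \in [set: int]) F i = \sum_(i <- r) F i.
Proof.
move=> ur Fr; rewrite (fsbigE r)//; last by move=> i _; exact: Fr.
by apply: eq_bigl => i; rewrite in_setT.
Qed.

Definition ltrunc N M f : {poly k} := \poly_(j < M) f (j%:Z - N%:Z).

Lemma lmulE f g N N' M d : lbound f N -> lbound g N' -> (d < M)%N ->
  lmul f g (d%:Z - (N + N')%:Z) = (ltrunc N M f * ltrunc N' M g)`_d.
Proof.
move=> fN gN dM; rewrite coefM /= /lmul_coef.
rewrite (@fsum_seq [seq j%:Z - N%:Z | j <- index_iota 0 d.+1]).
- rewrite -(big_mkord xpredT (fun j => (ltrunc N M f)`_j * (ltrunc N' M g)`_(d - j))).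
  rewrite big_map; apply: eq_big_nat => j /andP[_ jd].
  rewrite !coef_poly !ifT; [|lia|lia]; congr (_ * g _); lia.
- rewrite map_inj_uniq; first exact: iota_uniq.
  move=> i j; lia.
- move=> i0; move: (i0 : int) => i /negP iP; have [iN|iN] := ltP i (- N%:Z).
    by rewrite fN// mul0r.
  have [dN|dN] := ltP (d%:Z - (N + N')%:Z - i) (- N'%:Z).
    by rewrite gN// mulr0.
  by case: iP; apply/mapP; exists (absz (i + N%:Z)%R); rewrite ?mem_index_iota; lia.
Qed.

Lemma coefM_eq (p q p' q' : {poly k}) d :
  (forall i, (i <= d)%N -> p`_i = p'`_i) ->
  (forall i, (i <= d)%N -> q`_i = q'`_i) -> (p * q)`_d = (p' * q')`_d.
Proof.
move=> pp qq; rewrite !coefM; apply: eq_bigr => j _.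
by have := ltn_ord j; rewrite ltnS => jd; rewrite pp ?qq// leq_subr.
Qed.

Lemma lbound_mul f g N N' : lbound f N -> lbound g N' ->
  lbound (lmul f g) (N + N').
Proof. by move=> fN gN m; exact: lmul_coef_bound. Qed.

Lemma lbound_eq f g N : lbound f N -> lbound g N ->
  (forall d : nat, f (d%:Z - N%:Z) = g (d%:Z - N%:Z)) -> f = g.
Proof.
move=> fN gN fg; apply: lcoef_inj => m.
have [mN|mN] := ltP m (- N%:Z); first by rewrite fN// gN.
by have -> : m = (absz (m + N%:Z))%:Z - N%:Z by lia.
Qed.

Fact laddA : associative ladd.
Proof. by move=> f g h; apply: lcoef_inj => m /=; rewrite addrA. Qed.
Fact laddC : commutative ladd.
Proof. by move=> f g; apply: lcoef_inj => m /=; rewrite addrC. Qed.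
Fact ladd0 : left_id lzero ladd.
Proof. by move=> f; apply: lcoef_inj => m /=; rewrite add0r. Qed.
Fact laddN : left_inverse lzero lopp ladd.
Proof. by move=> f; apply: lcoef_inj => m /=; rewrite addNr. Qed.

HB.instance Definition _ :=
  GRing.isZmodule.Build (laurent k) laddA laddC ladd0 laddN.

Fact lmulC : commutative lmul.
Proof.
move=> f g; have [N [fN gN]] := lbound2 f g.
apply: (@lbound_eq _ _ (N + N)); try exact: lbound_mul.
by move=> d; rewrite !(@lmulE _ _ N N d.+1 d)// mulrC.
Qed.

Fact lmulA : associative lmul.
Proof.
move=> f g h; have [N fN] := lboundP f; have [N' gN] := lboundP g.
have [N'' hN] := lboundP h.
have ghN := lbound_mul gN hN; have fgN := lbound_mul fN gN.
apply: (@lbound_eq _ _ (N + (N' + N''))).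
- exact: lbound_mul.
- by rewrite addnA; exact: lbound_mul.
move=> d; rewrite (lmulE fN ghN (ltnSn d)).
rewrite addnA (lmulE fgN hN (ltnSn d)).
transitivity ((ltrunc N d.+1 f * (ltrunc N' d.+1 g * ltrunc N'' d.+1 h))`_d).
  apply: coefM_eq => // i id; rewrite coef_poly ltnS id.
  by rewrite (lmulE gN hN (_ : i < d.+1)%N).
rewrite mulrA; apply: coefM_eq => // i id; rewrite [RHS]coef_poly ltnS id.
by rewrite (lmulE fN gN (_ : i < d.+1)%N).
Qed.

Lemma lmono_mulE e f m : lmul (lmono e) f m = f (m - e).
Proof.
rewrite /= /lmul_coef (@fsum_seq [:: e])//=.
- by rewrite big_seq1 eqxx mul1r.
- by move=> i; rewrite inE => /negPf ->; rewrite mul0r.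
Qed.

Fact lmul1 : left_id (lmono 0) lmul.
Proof. by move=> f; apply: lcoef_inj => m; rewrite lmono_mulE subr0. Qed.

Fact lmulDl : left_distributive lmul ladd.
Proof.
move=> f g h; have [N [fN gN]] := lbound2 f g; have [N' hN] := lboundP h.
have fgN : lbound (ladd f g) N by move=> m mN /=; rewrite fN ?gN ?addr0.
have fhN := lbound_mul fN hN; have ghN := lbound_mul gN hN.
apply: (@lbound_eq _ _ (N + N')); first exact: lbound_mul.
  by move=> m mN /=; rewrite [lmul_coef f h m]fhN// [lmul_coef g h m]ghN// addr0.
move=> d; rewrite (lmulE fgN hN (ltnSn d)).
rewrite [RHS](_ : _ = lmul f h (d%:Z - (N + N')%:Z) +
                       lmul g h (d%:Z - (N + N')%:Z))//.
rewrite (lmulE fN hN (ltnSn d)) (lmulE gN hN (ltnSn d)) -coefD -mulrDl.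
by apply: coefM_eq => // i id; rewrite coefD !coef_poly ltnS id.
Qed.

Fact lone_neq0 : lmono 0 != 0.
Proof.
by apply/eqP => /(congr1 (fun f : laurent k => f 0)) /= /eqP; rewrite oner_eq0.
Qed.

HB.instance Definition _ := GRing.Zmodule_isComNzRing.Build (laurent k)
  lmulA lmulC lmul1 lmulDl lone_neq0.

Fact lscaleA a b f : lscale a (lscale b f) = lscale (a * b) f.
Proof. by apply: lcoef_inj => m /=; rewrite mulrA. Qed.
Fact lscale1 : left_id 1 lscale.
Proof. by move=> f; apply: lcoef_inj => m /=; rewrite mul1r. Qed.
Fact lscaleDr : right_distributive lscale +%R.
Proof. by move=> a f g; apply: lcoef_inj => m /=; rewrite mulrDr. Qed.
Fact lscaleDl f : {morph lscale^~ f : a b / a + b}.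
Proof. by move=> a b; apply: lcoef_inj => m /=; rewrite mulrDl. Qed.

HB.instance Definition _ := GRing.Zmodule_isLmodule.Build k (laurent k)
  lscaleA lscale1 lscaleDr lscaleDl.

Fact lscaleAl (a : k) f g : a *: (f * g) = (a *: f) * g.
Proof.
apply: lcoef_inj => m /=; rewrite /lmul_coef mulr_fsumr.
by apply: eq_fsbigr => i _; rewrite mulrA.
Qed.

HB.instance Definition _ :=
  GRing.Lmodule_isLalgebra.Build k (laurent k) lscaleAl.
HB.instance Definition _ := GRing.Lalgebra_isComAlgebra.Build k (laurent k).

Lemma lcoefD f g m : (f + g) m = f m + g m. Proof. by []. Qed.
Lemma lcoefN f m : (- f) m = - f m. Proof. by []. Qed.
Lemma lcoefB f g m : (f - g) m = f m - g m. Proof. by []. Qed.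
Lemma lcoefZ (c : k) f m : (c *: f) m = c * f m. Proof. by []. Qed.
Lemma lcoef0 m : (0 : laurent k) m = 0. Proof. by []. Qed.
Lemma lcoef1 m : (1 : laurent k) m = (m == 0)%:R. Proof. by []. Qed.
Lemma lcoef_mono e m : lmono e m = (m == e)%:R. Proof. by []. Qed.
Lemma lcoefM f g m :
  (f * g) m = \sum_(i \in [set: int]) f i * g (m - i).
Proof. by []. Qed.
Lemma lcoef_monoM e f m : (lmono e * f) m = f (m - e).
Proof. exact: lmono_mulE. Qed.

Lemma lmonoM e e' : lmono e * lmono e' = lmono (e + e').
Proof.
apply: lcoef_inj => m; rewrite lcoef_monoM !lcoef_mono; congr (_%:R).
by congr (nat_of_bool _); lia.
Qed.

Lemma lmonoX e n : lmono e ^+ n = lmono (e * n%:Z).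
Proof.
elim: n => [|n IHn]; first by rewrite mulr0.
by rewrite exprS IHn lmonoM; congr lmono; lia.
Qed.

End Ring.

(** * The decomposition k((t)) = k[[t]] (+) t^-1 k[t^-1] *)

Section Decomposition.
Variable k : fieldType.
Implicit Types f g : laurent k.

(** k[[t]] *)
Definition pseries : set (laurent k) :=
  [set f | forall m : int, m < 0 -> f m = 0].

(** k[t^-1], the image of k[X] under evaluation at t^-1 *)
Definition polyV : set (laurent k) :=
  range (horner_alg (lmono k (- 1)) : {poly k} -> laurent k).

(** t^-1 k[t^-1] *)
Definition polyV0 : set (laurent k) := [set lmono k (- 1) * f | f in polyV].

(** the constants k in k((t)) *)
Definition lconst : set (laurent k) := range (fun c : k => c%:A).

Fact lproj_subproof f :
  exists n : int, forall m : int, m < n -> (if 0 <= m then f m else 0) = 0.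
Proof. by exists 0 => m; rewrite ltNge => /negPf ->. Qed.

(** The projection onto k[[t]] along t^-1 k[t^-1], which discards the terms of
    negative degree; see [lproj_linear], [lproj_id], [range_lproj] and
    [ker_lproj]. *)
Definition lproj f : laurent k := Laurent (lproj_subproof f).

Lemma polyVP f : polyV f <-> forall m : int, 0 < m -> f m = 0.
Proof.
have coefE (q : {poly k}) (m : int) :
    (horner_alg (lmono k (- 1)) q) m = if 0 < m then 0 else q`_(absz m).
  have -> : horner_alg (lmono k (- 1)) q =
      \sum_(i < size q) q`_i *: lmono k (- i%:Z).
    rewrite /horner_alg /horner_morph horner_coef size_map_poly.
    by apply: eq_bigr => i _; rewrite coef_map /= mulr_algl lmonoX mulN1r.
  have -> (n : nat) (F : 'I_n -> laurent k) : (\sum_(i < n) F i) m = \sum_(i < n) F i m.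
    by apply: (big_morph (fun f : laurent k => f m)).
  have [m0|m0] := ltP 0 m.
    by apply: big1 => i _; rewrite lcoefZ lcoef_mono (_ : _ == _ = false) ?mulr0//; lia.
  have [mq|mq] := ltnP (absz m) (size q).
    rewrite (bigD1 (Ordinal mq))//= big1 ?addr0.
      by rewrite (_ : _ == _ = true) ?mulr1//; lia.
    move=> i im; rewrite (_ : _ == _ = false) ?mulr0//.
    by apply: contra_neqF im => /eqP mi; apply: val_inj => /=; lia.
  rewrite nth_default//; apply: big1 => i _; rewrite lcoefZ lcoef_mono.
  by rewrite (_ : _ == _ = false) ?mulr0//; have := ltn_ord i; lia.
split=> [[q _ <-] m m0|fP]; first by rewrite coefE m0.
have [N fN] := lboundP f.
exists (\poly_(i < N.+1) f (- i%:Z)) => //; apply: lcoef_inj => m.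
rewrite coefE; have [m0|m0] := ltP 0 m; first by rewrite fP.
rewrite coef_poly; case: ifP => mN; first by congr (lcoef f _); lia.
by rewrite fN//; lia.
Qed.

Lemma polyV0P f : polyV0 f <-> forall m : int, 0 <= m -> f m = 0.
Proof.
split=> [[g /polyVP gP <-] m m0|fP].
  by rewrite lcoef_monoM gP//; lia.
exists (lmono k 1 * f); last by rewrite mulrA lmonoM addNr mul1r.
apply/polyVP => m m0; rewrite lcoef_monoM; apply: fP; lia.
Qed.

Lemma lproj_linear : linear lproj.
Proof.
move=> c f g; apply: lcoef_inj => m.
rewrite lcoefD lcoefZ /=; case: ifP => // _; by rewrite mulr0 addr0.
Qed.

Lemma lproj_id f : lproj (lproj f) = lproj f.
Proof. by apply: lcoef_inj => m /=; case: (0 <= m). Qed.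

Lemma range_lproj : range lproj = pseries.
Proof.
apply/seteqP; split=> [_ [f _ <-] m m0|f fP] /=; first by rewrite leNgt m0.
exists f => //; apply: lcoef_inj => m /=.
by case: ifP => // /negbT; rewrite -ltNge => /fP.
Qed.

Lemma ker_lproj : [set f | lproj f = 0] = polyV0.
Proof.
apply/seteqP; split=> f /=.
  by move=> f0; apply/polyV0P => m m0; have := congr1 (fun g : laurent k => g m) f0; rewrite /= m0.
by move=> /polyV0P fP; apply: lcoef_inj => m /=; case: ifP => // /fP.
Qed.

End Decomposition.

Arguments pseries k : clear implicits.
Arguments polyV k : clear implicits.
Arguments polyV0 k : clear implicits.
Arguments lconst k : clear implicits.

(** * Rota-Baxter operators and regular-singular decompositions *)

Section Modules.
Variables (k : fieldType) (V : lmodType (laurent k)).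
Implicit Types (p : V -> V) (M N : set V).

(** [V] is a k-vector space through the constants k in k((t)). *)
Definition klinear p :=
  forall (c : k) (x y : V),
    p ((c%:A : laurent k) *: x + y) = (c%:A : laurent k) *: p x + p y.

Definition RB : set (V -> V) := [set p | klinear p /\
  forall (a : laurent k) (x : V),
    lproj a *: p x = p (lproj a *: x + a *: p x - a *: x)].

Definition stable_submod (S : set (laurent k)) M :=
  [/\ M 0, (forall x y, M x -> M y -> M (x + y))
    & forall a x, S a -> M x -> M (a *: x)].

Definition direct_sum M N :=
  M `&` N = [set 0] /\ forall v, exists x y, [/\ M x, N y & v = x + y].

Definition RSD : set (set V * set V) := [set MN |
  [/\ stable_submod (lconst k) MN.1, stable_submod (lconst k) MN.2,
      direct_sum MN.1 MN.2,
      stable_submod (pseries k) MN.1 & stable_submod (polyV k) MN.2]].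

Definition Psi p : set V * set V := (range p, [set x | p x = 0]).

Record GL := MkGL {
  gl_fun :> {linear V -> V};
  gl_inv : V -> V;
  gl_funK : cancel gl_fun gl_inv;
  gl_invK : cancel gl_inv gl_fun }.

Definition actRB (phi : GL) p : V -> V := phi \o p \o gl_inv phi.

Definition actRSD (phi : GL) (MN : set V * set V) : set V * set V :=
  (phi @` MN.1, phi @` MN.2).

Lemma gl_inv_linear (phi : GL) : linear (gl_inv phi).
Proof.
move=> a x y; apply: (can_inj (gl_funK phi)).
by rewrite linearP !gl_invK.
Qed.

Lemma actRB_RB (phi : GL) p : RB p -> RB (actRB phi p).
Proof.
have addP x y : gl_inv phi (x + y) = gl_inv phi x + gl_inv phi y.
  by have := gl_inv_linear phi 1 x y; rewrite !scale1r.
have gl0 : gl_inv phi 0 = 0.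
  by apply: (addrI (gl_inv phi 0)); rewrite -addP !addr0.
have scaleP a x : gl_inv phi (a *: x) = a *: gl_inv phi x.
  by have := gl_inv_linear phi a x 0; rewrite gl0 !addr0.
case=> pk pRB; split=> [c x y|a x]; rewrite /actRB /=.
  by rewrite addP scaleP pk linearP.
by rewrite -linearZ pRB -!scaleNr !addP !scaleP gl_funK.
Qed.

Lemma actRSD_RSD (phi : GL) MN : RSD MN -> RSD (actRSD phi MN).
Proof.
case: MN => M N [/= Mk Nk [MN0 MNV] MO NV].
have stab S L : stable_submod S L -> stable_submod S (phi @` L).
  case=> L0 LD LZ; split.
  - by exists 0 => //; rewrite linear0.
  - by move=> _ _ [x Lx <-] [y Ly <-]; exists (x + y); rewrite ?linearD//; exact: LD.
  - by move=> a _ Sa [x Lx <-]; exists (a *: x); rewrite ?linearZ//; exact: LZ.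
split => /=; try exact: stab.
split.
  apply/seteqP; split=> [_ [[x Mx <-] [y Ny /(can_inj (gl_funK phi)) yx]]|_ ->] /=.
    have : (M `&` N) x by split=> //; rewrite -yx.
    by rewrite MN0 => ->; rewrite linear0.
  have [M0 N0] : (M `&` N) 0 by rewrite MN0.
  by split; exists 0; rewrite ?linear0.
move=> v; have [x [y [Mx Ny vE]]] := MNV (gl_inv phi v).
exists (phi x), (phi y); split; [by exists x | by exists y |].
by rewrite -linearD -vE gl_invK.
Qed.

End Modules.

Arguments RB {k} V.
Arguments RSD {k} V.
Arguments Psi {k V} p.

(* Main.v *)
Require Import Defs.
From mathcomp Require Import all_boot all_order all_algebra.
From mathcomp Require Import boolp classical_sets functions.

(** Write P for the projection [lproj] of k((t)) onto k[[t]] along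
    t^-1 k[t^-1].  Any Laurent series splits as a = P(a) + (a - P(a)), and
    the argument of p in the Rota-Baxter identity splits accordingly:

      P(a) x + a p(x) - a x = P(a) p(x) + (a - P(a)) (p(x) - x).

    So the identity separates into two independent conditions.  For a in
    k[[t]] it says that p(a p(x)) = a p(x); the case a = 1 makes p idempotent,
    and the other cases make its image a k[[t]]-module.  For a in t^-1 k[t^-1]
    it says that p kills a (p(x) - x), that is, t^-1 k[t^-1] preserves the
    image of p - 1, which is the kernel of p when p is idempotent.  In other
    words, Rota-Baxter operators are exactly the k-linear projections whose
    image is a k[[t]]-module and whose kernel is a k[t^-1]-module
    ([RB_Psi_RSD] in one direction, [RB_projection] in the other).  A linear
    projection is determined by its image and kernel ([idempotent_inj]), and
    exists for every pair of complementary subspaces ([complement_projection]),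
    which gives the bijection.  Equivariance holds because conjugating any map
    by phi transports its image and its kernel along phi. *)

Set Implicit Arguments.
Unset Strict Implicit.
Unset Printing Implicit Defensive.
Import Order.TTheory GRing.Theory Num.Theory.
Local Open Scope classical_set_scope.
Local Open Scope ring_scope.

Section LaurentConstants.
Variable k : fieldType.
Implicit Types f : laurent k.

Lemma lcoef_alg (c : k) (m : int) :
  (c%:A : laurent k) m = if m == 0 then c else 0.
Proof. by rewrite lcoefZ lcoef1; case: eqP; rewrite (mulr1, mulr0). Qed.

Lemma lconst_pseries : lconst k `<=` pseries k.
Proof. by move=> _ [c _ <-] m m0; rewrite lcoef_alg lt_eqF. Qed.

Lemma lconst_polyV : lconst k `<=` polyV k.
Proof. by move=> _ [c _ <-]; apply/polyVP => m m0; rewrite lcoef_alg gt_eqF. Qed.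

Lemma lproj_pseries f : pseries k f -> lproj f = f.
Proof. by rewrite -range_lproj => -[g _ <-]; rewrite lproj_id. Qed.

Lemma pseries_lproj f : pseries k (lproj f).
Proof. by rewrite -range_lproj; exists f. Qed.

Lemma polyV_sub_lproj f : polyV k (f - lproj f).
Proof. by apply/polyVP => m m0; rewrite lcoefB /= ltW// subrr. Qed.

(** k[[t]] and k[t^-1] overlap exactly in the constants. *)
Lemma lproj_polyV f : polyV k f -> lproj f = (f 0)%:A.
Proof.
move=> /polyVP fP; apply: lcoef_inj => m; rewrite lcoef_alg /=.
by case: (ltgtP 0 m) => [/fP|//|<-].
Qed.

End LaurentConstants.

Section LinearProjections.
Variables (k : fieldType) (V : lmodType (laurent k)).
Implicit Types (p q : V -> V) (M N : set V).

Lemma stable_submodS (S T : set (laurent k)) M :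
  S `<=` T -> stable_submod T M -> stable_submod S M.
Proof. by move=> ST [M0 MD MZ]; split=> // a x /ST; exact: MZ. Qed.

Lemma klinearD p : klinear p -> {morph p : x y / x + y}.
Proof. by move=> pk x y; have := pk 1 x y; rewrite !scale1r. Qed.

Lemma klinear0 p : klinear p -> p 0 = 0.
Proof. by move=> pk; apply: (addrI (p 0)); rewrite -klinearD// !addr0. Qed.

Lemma klinearZ p (c : k) x :
  klinear p -> p ((c%:A : laurent k) *: x) = (c%:A : laurent k) *: p x.
Proof. by move=> pk; have := pk c x 0; rewrite (klinear0 pk) !addr0. Qed.

Lemma klinearN p x : klinear p -> p (- x) = - p x.
Proof. by move=> pk; have := klinearZ (-1) x pk; rewrite scaleNr !scale1r !scaleN1r. Qed.

Lemma klinearB p x y : klinear p -> p (x - y) = p x - p y.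
Proof. by move=> pk; rewrite klinearD// klinearN. Qed.

Lemma idempotent_direct_sum p : klinear p -> (forall x, p (p x) = p x) ->
  direct_sum (range p) [set x | p x = 0].
Proof.
move=> pk pp; split=> [|v].
  apply/seteqP; split=> [_ [[x _ <-] /=]|_ ->]; first by rewrite pp.
  by split=> /=; [exists 0 => // |]; exact: klinear0.
exists (p v), (v - p v); split; first by exists v.
- by rewrite /= klinearB// pp subrr.
- by rewrite addrC subrK.
Qed.

(** If q has the image and the kernel of p, then p fixes q x, and kills
    x - q x; hence p x = p (q x) = q x. *)
Lemma idempotent_inj p q : klinear p -> klinear q ->
  (forall x, p (p x) = p x) -> (forall x, q (q x) = q x) ->
  Psi p = Psi q -> p = q.
Proof.
move=> pk qk pp qq [im_pq ker_pq]; apply/funext => x.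
have : range p (q x) by rewrite im_pq; exists x.
case=> y _ pyq; have pq : p (q x) = q x by rewrite -pyq pp.
have : [set z | p z = 0] (x - q x) by rewrite ker_pq /= klinearB// qq subrr.
by rewrite /= klinearB// pq => /subr0_eq.
Qed.

(** Complementary subspaces give every vector a unique M-component; choosing it
    gives a linear map since the sum of two decompositions is again one. *)
Lemma complement_projection M N :
  stable_submod (lconst k) M -> stable_submod (lconst k) N ->
  direct_sum M N ->
  exists p, [/\ klinear p, (forall x, M x -> p x = x),
                (forall x, N x -> p x = 0) & Psi p = (M, N)].
Proof.
move=> [M0 MD MZ] [N0 ND NZ] [MN0 MNV].
have constP (c : k) : lconst k c%:A by exists c.
have oppP L x : (forall a y, lconst k a -> L y -> L (a *: y)) -> L x -> L (- x).
  by move=> LZ Lx; have := LZ _ _ (constP (-1)) Lx; rewrite !scaleN1r.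
have uniq x x' y y' : M x -> M x' -> N y -> N y' -> x + y = x' + y' -> x = x'.
  move=> Mx Mx' Ny Ny' xy; apply: subr0_eq.
  have xyE : x - x' = y' - y.
    by apply/eqP; rewrite subr_eq addrAC eq_sym subr_eq addrC xy addrC.
  have : (M `&` N) (x - x').
    by split; [|rewrite xyE]; [apply: MD|apply: ND] => //; apply: oppP.
  by rewrite MN0.
have [p pP] : {p : V -> V & forall v, M (p v) /\ N (v - p v)}.
  apply: (@choice _ _ (fun v m => M m /\ N (v - m))) => v.
  by have [x [y [Mx Ny ->]]] := MNV v; exists x; rewrite addrAC subrr add0r.
have pE x y : M x -> N y -> p (x + y) = x.
  move=> Mx Ny; have [Mp Np] := pP (x + y).
  by apply: (uniq _ _ _ _ Mp Mx Np Ny); rewrite addrC subrK.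
have pM x : M x -> p x = x by move=> Mx; rewrite -[x in p x]addr0 pE.
have pN x : N x -> p x = 0 by move=> Nx; rewrite -[x in p x]add0r pE.
exists p; split=> // [c x y|].
  have [[Mx Nx] [My Ny]] := (pP x, pP y).
  have -> : (c%:A : laurent k) *: x + y =
      ((c%:A : laurent k) *: p x + p y) +
      ((c%:A : laurent k) *: (x - p x) + (y - p y)).
    by rewrite addrACA -scalerDr ![_ + (_ - _)]addrC !subrK.
  by rewrite pE//; [apply: MD => //; apply: MZ|apply: ND => //; apply: NZ].
congr pair; apply/seteqP; split=> x /=.
- by case=> y _ <-; have [] := pP y.
- by move=> Mx; exists x => //; exact: pM.
- by have [_ +] := pP x => + px0; rewrite px0 subr0.
- exact: pN.
Qed.

End LinearProjections.

Section RotaBaxter.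
Variables (k : fieldType) (V : lmodType (laurent k)).
Implicit Types (p : V -> V) (M N : set V).

(** P fixes k[[t]], so there the two terms of the Rota-Baxter identity without
    inner p cancel. *)
Lemma RB_pseriesZ p a x : RB V p -> pseries k a -> p (a *: p x) = a *: p x.
Proof.
move=> [_ pRB] /lproj_pseries aE; have := pRB a x.
by rewrite aE addrAC subrr add0r => <-.
Qed.

Lemma RB_idempotent p x : RB V p -> p (p x) = p x.
Proof.
move=> pRB; have := @RB_pseriesZ p 1 x pRB; rewrite !scale1r; apply.
by move=> m m0; rewrite lcoef1 lt_eqF.
Qed.

(** When p x = 0 the Rota-Baxter identity says that a and P(a) act on x in the
    same way modulo the kernel; for a in k[t^-1], P(a) is a constant. *)
Lemma RB_ker_polyV p a x : RB V p -> polyV k a -> p x = 0 -> p (a *: x) = 0.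
Proof.
move=> [pk pRB] /lproj_polyV aE px0; have := pRB a x.
rewrite px0 !scaler0 addr0 klinearB// aE klinearZ// px0 scaler0 sub0r.
by move=> /esym/eqP; rewrite oppr_eq0 => /eqP.
Qed.

Lemma RB_Psi_RSD p : RB V p -> RSD V (Psi p).
Proof.
move=> pRB; have pk : klinear p by case: pRB.
have im_p : stable_submod (pseries k) (range p).
  split; first by exists 0 => //; exact: klinear0.
    by move=> _ _ [x _ <-] [y _ <-]; exists (x + y) => //; exact: klinearD.
  by move=> a _ aO [x _ <-]; exists (a *: p x) => //; exact: RB_pseriesZ.
have ker_p : stable_submod (polyV k) [set x | p x = 0].
  split=> [|x y /= px0 py0|a x aV /=]; first exact: klinear0.
    by rewrite klinearD// px0 py0 addr0.
  exact: RB_ker_polyV.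
split=> //=.
- exact: stable_submodS (@lconst_pseries k) im_p.
- exact: stable_submodS (@lconst_polyV k) ker_p.
- by apply: idempotent_direct_sum => // x; exact: RB_idempotent.
Qed.

(** The argument P(a) x + a p(x) - a x regroups as P(a) p(x), which lies in M
    and is fixed by p, plus (a - P(a)) (p(x) - x), which lies in N because
    a - P(a) is a polynomial in t^-1. *)
Lemma RB_projection p M N :
  klinear p -> (forall x, M x -> p x = x) -> (forall x, N x -> p x = 0) ->
  (forall x, M (p x)) -> (forall x, N (p x - x)) ->
  stable_submod (pseries k) M -> stable_submod (polyV k) N -> RB V p.
Proof.
move=> pk pM pN Mp Np [_ _ MZ] [_ _ NZ]; split=> // a x.
have -> : lproj a *: x + a *: p x - a *: x =
    lproj a *: p x + (a - lproj a) *: (p x - x).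
  rewrite scalerBl !scalerBr opprB [RHS]addrCA [X in _ = _ + X]addrC subrK.
  by rewrite [RHS]addrC addrA.
rewrite (klinearD pk) [p (lproj a *: _)]pM; last first.
  by apply: MZ => //; exact: pseries_lproj.
by rewrite [p ((a - _) *: _)]pN ?addr0//; apply: NZ => //;
  exact: polyV_sub_lproj.
Qed.

Lemma RSD_Psi_RB M N : RSD V (M, N) -> exists2 p, RB V p & Psi p = (M, N).
Proof.
move=> [/= Mk Nk MNV MO NV].
have [p [pk pM pN PsiE]] := complement_projection Mk Nk MNV.
exists p => //; case: PsiE => imE kerE.
have Mp x : M (p x) by rewrite -imE; exists x.
apply: (RB_projection pk pM pN) => // x.
by rewrite -kerE /= klinearB// pM// subrr.
Qed.

Lemma Psi_actRB (phi : GL V) p : Psi (actRB phi p) = actRSD phi (Psi p).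
Proof.
congr pair; apply/seteqP; split=> x /=.
- by case=> y _ <-; exists (p (gl_inv phi y)) => //; exists (gl_inv phi y).
- by case=> _ [y _ <-] <-; exists (phi y) => //; rewrite /actRB /= gl_funK.
- move=> px0; exists (gl_inv phi x); rewrite ?gl_invK//=.
  by apply: (can_inj (gl_funK phi)); rewrite linear0.
- by case=> y py0 <-; rewrite /actRB /= gl_funK py0 linear0.
Qed.

End RotaBaxter.

Theorem theorem2p4 (k : fieldType) (V : lmodType (laurent k)) :
  set_bij (RB V) (RSD V) Psi /\
  (forall (phi : GL V) (p : V -> V), RB V p ->
     Psi (actRB phi p) = actRSD phi (Psi p)).
Proof.
split; last by move=> phi p _; exact: Psi_actRB.
split=> [p|p q|[M N] /RSD_Psi_RB[p pRB <-]]; first exact: RB_Psi_RSD.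
  rewrite !inE => pRB qRB; have [pk _] := pRB; have [qk _] := qRB.
  by apply: idempotent_inj => // x; exact: RB_idempotent.
by exists p.
Qed.
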